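(* For every $n\ge 1$, the image under $\Gamma$ of the set $\mathbf S_n(\underline{132},\underline{123})$ is exactly $\mathcal L_n$, and for every involution $\pi\in\mathbf I_n$ one has $F(\pi)\in\mathbf S_n(\underline{132},\underline{123})$ and $\Gamma(F(\pi))=\Psi(\pi)$; that is, $\Psi=\Gamma\circ F$ on $\mathbf I_n$.
   Context: A Motzkin path of length $n$ is a word $d_1\cdots d_n$ over $\{U,D,H\}$ (steps $(1,1),(1,-1),(1,0)$) starting at $(0,0)$, ending at $(n,0)$, never going below the $x$-axis. A bicolored Motzkin path additionally allows horizontal steps of a second color, written $\widetilde H$, which may not lie on the $x$-axis. The height $h_i$ of step $d_i$ is the $y$-coordinate of its ending point if $d_i=D$, and of its starting point otherwise. A histoire de Laguerre of length $n$ is a pair $(d,l)$ with $d$ a bicolored Motzkin path of length $n$ and $l=(l_1,\dots,l_n)$ nonnegative integers with $l_i\le h_i$ for all $i$. $\mathcal L_n$ is the set of histoires de Laguerre $(d,l)$ such that $d$ has no $\widetilde H$ steps and $l_i>0$ only if $d_i=D$ (Motzkin paths whose down steps are labelled by an integer between $0$ and their height). The map $\Gamma$: for $\pi\in\mathbf S_n$ (one-line notation), write $\pi=w_1\cdots w_k$ as the concatenation of its ascending runs (maximal increasing factors). The first and last elements of a run of length $\ge2$ are a head and a tail; the element of a run of length $1$ is a head-tail; other elements are boarders. For each value $i\in\{1,\dots,n\}$ put $d_i=H$ if $i$ is a head-tail, $U$ if $i$ is a head, $D$ if $i$ is a tail, $\widetilde H$ if $i$ is a boarder. Let $l_i=|\{j: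 s_j<i<t_j,\ t_j \text{ precedes } i \text{ in } \pi\}|$, where $s_j,t_j$ are the first and last elements of $w_j$. Then $\Gamma(\pi)=(d_1\cdots d_n,(l_1,\dots,l_n))$. The map $F$ on involutions: write the involution in standard cycle notation (each cycle with its least element first, cycles in decreasing order of their least elements) and erase the parentheses; e.g. $(6)(5,8)(3)(2,7)(1,4)\mapsto 65832714$. The map $\Psi$ on $\mathbf I_n$ (involutions of $\{1,\dots,n\}$): for $i=1,\dots,n$, $d_i=H$ (label $0$) if $i$ is a fixed point; $d_i=U$ (label $0$) if $i$ is the smaller element of a 2-cycle; $d_i=D$ if $i$ is the larger element of a 2-cycle $(j,i)$, with label $l_i$ equal to the number of 2-cycles $(x,y)$, $x<y$, of $\pi$ with $j<x<i<y$. $\Psi(\pi)=(d,l)$. $\mathbf S_n(\underline{132},\underline{123})$ is the set of $\pi\in\mathbf S_n$ having no three consecutive entries $\pi_i\pi_{i+1}\pi_{i+2}$ order-isomorphic to $132$ or to $123$. *)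

(* Defs.v *)
From HB Require Import structures.
From mathcomp Require Import all_boot all_order all_algebra all_fingroup.

Set Implicit Arguments.
Unset Strict Implicit.
Unset Printing Implicit Defensive.

(* The ground set {1, ..., n} is represented by 'I_n = {0, ..., n-1}: the      *)
(* value (or index) i of the mathematics is the ordinal i - 1.  All notions    *)
(* below depend only on the relative order of the values.                      *)

Inductive step : Set := Up | Down | Hor | Hor2. (* Hor2 is the second horizontal colour *)

Definition step_code (x : step) : bool * bool :=
  match x with
  | Up => (false, false) | Down => (false, true)
  | Hor => (true, false) | Hor2 => (true, true)
  end.

Definition step_decode (c : bool * bool) : step :=
  match c with
  | (false, false) => Up | (false, true) => Down
  | (true, false) => Hor | (true, true) => Hor2
  end.

Lemma step_codeK : cancel step_code step_decode.
Proof. by case. Qed.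

HB.instance Definition _ := Countable.copy step (can_type step_codeK).

Definition rise (x : step) : int :=
  match x with Up => 1%R | Down => (- 1)%R | Hor | Hor2 => 0%R end.

Definition ordinate (d : seq step) (k : nat) : int :=
  (\sum_(x <- take k d) rise x)%R.

Definition bicolored_motzkin n (d : n.-tuple step) : bool :=
  [&& [forall k : 'I_n.+1, (0 <= ordinate d k)%R],
      ordinate d n == 0%R
    & [forall i : 'I_n, (tnth d i == Hor2) ==> (ordinate d i != 0%R)]].

(* The i-th step (i counted from 0) goes from abscissa i to abscissa i.+1. *)
Definition height n (d : n.-tuple step) (i : 'I_n) : int :=
  if tnth d i == Down then ordinate d i.+1 else ordinate d i.

Definition histoire (n : nat) : Type := (n.-tuple step * n.-tuple nat)%type.

Definition histoire_de_Laguerre n (dl : histoire n) : bool :=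
  bicolored_motzkin dl.1
  && [forall i : 'I_n, ((tnth dl.2 i)%:Z <= height dl.1 i)%R].

Definition calL n (dl : histoire n) : bool :=
  [&& histoire_de_Laguerre dl,
      [forall i : 'I_n, tnth dl.1 i != Hor2]
    & [forall i : 'I_n, (0 < tnth dl.2 i) ==> (tnth dl.1 i == Down)]].

Definition one_line n (s : 'S_n) : seq nat := [seq val (s i) | i <- enum 'I_n].

Definition order_isomorphic (u v : seq nat) : bool :=
  (size u == size v)
  && [forall i : 'I_(size u), forall j : 'I_(size u),
        (nth 0 u i < nth 0 u j) == (nth 0 v i < nth 0 v j)].

(* Factors truncated by the end of w are excluded by the size test in
   order_isomorphic. *)
Definition has_consecutive (p w : seq nat) : bool :=
  [exists k : 'I_(size w), order_isomorphic (take (size p) (drop k w)) p].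

Definition Sav (n : nat) (ps : seq (seq nat)) : {set 'S_n} :=
  [set s : 'S_n | all (fun p => ~~ has_consecutive p (one_line s)) ps].

Definition involutions (n : nat) : {set 'S_n} := [set s : 'S_n | (s * s == 1)%g].

Fixpoint runs (w : seq nat) : seq (seq nat) :=
  if w is x :: w' then
    match runs w' with
    | (y :: r) :: rs =>
        if x < y then (x :: y :: r) :: rs else [:: x] :: (y :: r) :: rs
    | _ => [:: [:: x]]
    end
  else [::].

(* runs w is the factorization of w into maximal increasing factors: the
   factors are nonempty and increasing, and no two consecutive ones can be
   merged. *)
Lemma runsP (w : seq nat) :
  [/\ flatten (runs w) = w,
      all (fun r => (r != [::]) && sorted ltn r) (runs w)
    & sorted (fun r r' => head 0 r' <= last 0 r) (runs w)].
Proof.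
elim: w => [|x w [IHf IHa IHs]] //=.
case E: (runs w) IHf IHa IHs => [|[|y r] rs] //=; first by move<-.
move=> <- /andP[yr rsok] srs; case: ltnP => xy.
  split=> //=; first by rewrite xy yr rsok.
  by case: rs srs {E rsok} => //= r' rs /andP[-> ->].
by split=> //=; rewrite ?yr ?rsok ?xy ?srs.
Qed.

(* In the next definitions the default values of head and last are irrelevant:
   runs are nonempty. *)
Definition is_head_tail (w : seq nat) (i : nat) : bool :=
  has (fun r => r == [:: i]) (runs w).

Definition is_head (w : seq nat) (i : nat) : bool :=
  has (fun r => (2 <= size r) && (head 0 r == i)) (runs w).

Definition is_tail (w : seq nat) (i : nat) : bool :=
  has (fun r => (2 <= size r) && (last 0 r == i)) (runs w).

Definition Gamma_step (w : seq nat) (i : nat) : step :=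
  if is_head_tail w i then Hor
  else if is_head w i then Up
  else if is_tail w i then Down
  else Hor2.

Definition precedes (w : seq nat) (a b : nat) : bool := index a w < index b w.

Definition Gamma_label (w : seq nat) (i : nat) : nat :=
  count (fun r => (head 0 r < i < last 0 r) && precedes w (last 0 r) i) (runs w).

Definition Gamma n (s : 'S_n) : histoire n :=
  ([tuple Gamma_step (one_line s) i | i < n],
   [tuple Gamma_label (one_line s) i | i < n]).

(* fingraph.orbit s i lists the cycle i, s i, s (s i), ... of s starting at i;
   the definition makes sense for every permutation. *)
Definition standard_cycles n (s : 'S_n) : seq (seq 'I_n) :=
  [seq fingraph.orbit s i
     | i : 'I_n <- rev (enum 'I_n) & all (fun j : 'I_n => i <= j) (fingraph.orbit s i)].

Definition F_word n (s : 'S_n) : seq 'I_n := flatten (standard_cycles s).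

Lemma mem_F_word n (s : 'S_n) (j : 'I_n) : j \in F_word s.
Proof.
have [i ci mini] := @arg_minnP _ j (fun i => fconnect s j i) val (connect0 _ _).
have sym := fconnect_sym (@perm_inj _ s).
apply/flattenP; exists (fingraph.orbit s i); last by rewrite -fconnect_orbit sym.
apply: map_f; rewrite mem_filter mem_rev mem_enum andbT.
apply/allP => k; rewrite -fconnect_orbit => ck.
exact/mini/(connect_trans ci).
Qed.

Lemma uniq_F_word n (s : 'S_n) : uniq (F_word s).
Proof.
rewrite /F_word /standard_cycles.
set P := fun i : 'I_n => all _ _.
have sym := fconnect_sym (@perm_inj _ s).
have: uniq (filter P (rev (enum 'I_n))) by rewrite filter_uniq ?rev_uniq ?enum_uniq.
have: all P (filter P (rev (enum 'I_n))) by exact: filter_all.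
elim: (filter _ _) => //= i t IHt /andP[Pi Pt] /andP[it ut].
rewrite cat_uniq orbit_uniq IHt // andbT.
apply/hasPn => j /flattenP[_ /mapP[k kt ->] jk].
apply: contra it; rewrite -fconnect_orbit => cij.
suff -> : i = k by [].
have cik : fconnect s i k.
  by apply: connect_trans cij _; rewrite sym fconnect_orbit.
apply/val_inj/eqP; rewrite eqn_leq; apply/andP; split.
  by move/allP: Pi; apply; rewrite -fconnect_orbit.
by have /allP := allP Pt k kt; apply; rewrite -fconnect_orbit sym.
Qed.

Lemma size_F_word n (s : 'S_n) : size (F_word s) == n.
Proof.
apply/eqP; rewrite -[RHS](size_enum_ord n); apply: perm_size.
apply: uniq_perm; rewrite ?uniq_F_word ?enum_uniq // => j.
by rewrite mem_F_word mem_enum.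
Qed.

Lemma F_inj n (s : 'S_n) : injective (tnth (Tuple (size_F_word s))).
Proof. by apply/tuple_uniqP; exact: uniq_F_word. Qed.

Definition Fmap n (s : 'S_n) : 'S_n := perm (@F_inj n s).

Lemma one_line_Fmap n (s : 'S_n) : one_line (Fmap s) = map val (F_word s).
Proof.
have -> : F_word s = [seq tnth (Tuple (size_F_word s)) i | i <- enum 'I_n].
  by rewrite map_tnth_enum.
by rewrite -map_comp; apply: eq_map => i /=; rewrite permE.
Qed.

Definition is_2cycle n (s : 'S_n) (p : 'I_n * 'I_n) : bool :=
  [&& p.1 < p.2, s p.1 == p.2 & s p.2 == p.1].

Definition Psi_step n (s : 'S_n) (i : 'I_n) : step :=
  if s i == i then Hor
  else if [exists j : 'I_n, is_2cycle s (i, j)] then Up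
  else Down.

(* For i the larger element of a 2-cycle (j, i), j = s i. *)
Definition Psi_label n (s : 'S_n) (i : 'I_n) : nat :=
  if Psi_step s i == Down then
    #|[set p : 'I_n * 'I_n | is_2cycle s p && (s i < p.1 < i) && (i < p.2)]|
  else 0.

Definition Psi n (s : 'S_n) : histoire n :=
  ([tuple Psi_step s i | i < n], [tuple Psi_label s i | i < n]).

(* Main.v *)
Require Import Defs.
From mathcomp Require Import all_boot all_order all_algebra all_fingroup.
From mathcomp Require Import zify.

(** A permutation avoids the consecutive patterns 132 and 123 exactly when no
entry is smaller than both of the next two, i.e. when its ascending runs have
length at most 2 and decreasing first elements.  These are the words [F s], the
runs being the cycles of the involution [s].  For such a word, a run precedes
[i] iff its head exceeds the head of the run of [i]; so only tails get nonzero
labels, and the label of a tail counts the same 2-cycles in [Gamma] as in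
[Psi].  The ordinate of the path at abscissa [k] is the number of runs with
[head < k <= last], whence the image lies in [calL].

Conversely, a labelled path is read from left to right: a down step labelled
[l] is matched with the unmatched up step having exactly [l] unmatched up
steps after it.  The resulting involution has the given path as [Psi]. *)

Set Implicit Arguments.
Unset Strict Implicit.
Unset Printing Implicit Defensive.

(** * Words whose runs are short and have decreasing heads *)

Definition block (r : seq nat) : bool :=
  match r with [:: _] => true | [:: a; b] => a < b | _ => false end.

Definition head_gt (r r' : seq nat) : bool := head 0 r' < head 0 r.

Definition block_seq (bs : seq (seq nat)) : bool :=
  all block bs && sorted head_gt bs.

Lemma head_gt_trans : transitive head_gt.
Proof. by move=> r q p; rewrite /head_gt => h1 h2; apply: ltn_trans h2 h1. Qed.

Lemma blockP r :
  block r -> (exists a, r = [:: a]) \/ (exists a b, a < b /\ r = [:: a; b]).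
Proof.
by case: r => [|a [|b [|c r]]] //= h; [left; exists a | right; exists a, b].
Qed.

Lemma block_seq_cons b bs :
  block_seq (b :: bs) = [&& block b, all (head_gt b) bs & block_seq bs].
Proof.
by rewrite /block_seq /= path_sortedE; [lia | exact: head_gt_trans].
Qed.

Lemma block_seq_uniq bs : block_seq bs -> uniq bs.
Proof.
case/andP=> _; apply: sorted_uniq; first exact: head_gt_trans.
by move=> r; rewrite /head_gt ltnn.
Qed.

Lemma runs_cons y w : exists r rs, runs (y :: w) = (y :: r) :: rs.
Proof.
rewrite /=; case: (runs w) => [|[|z r] rs]; try by exists [::], [::].
by case: ifP => _; [exists (z :: r), rs | exists [::], ((z :: r) :: rs)].
Qed.

Lemma flatten_runs w : flatten (runs w) = w.
Proof. by case: (runsP w). Qed.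

Fixpoint no_min_first (w : seq nat) : bool :=
  if w is a :: w' then
    (if w' is b :: c :: _ then ~~ ((a < b) && (a < c)) else true)
    && no_min_first w'
  else true.

(** Induction on the word: a new first letter either forms a run by itself, with a larger head, or
    is prepended to the first run of the rest; the condition on minima controls the second case. *)
Lemma runs_block_seq w : uniq w -> no_min_first w -> block_seq (runs w).
Proof.
elim: w => [|a w IH] //; rewrite cons_uniq => /andP[aw uw] /=.
case: w IH aw uw => [|y w] // IH aw uw /andP[hw /(IH uw) {IH}].
have := flatten_runs (y :: w).
have [r [rs ->]] := runs_cons y w => /= -[ew].
rewrite !block_seq_cons => /and3P[by_ hh hb].
have {aw} /andP[ay aw] : (a != y) && (a \notin w) by rewrite inE negb_or in aw.
case: ltnP => le_ay; last first.
  rewrite !block_seq_cons by_ hh hb /= {1}/head_gt /= andbT.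
  have lt_ya : y < a by lia.
  rewrite lt_ya; apply/allP => r' /(allP hh); rewrite /head_gt /=; lia.
rewrite block_seq_cons hb andbT.
(* Here [a] joins the run of [y]. That run has no second element [c], since [a < y < c] would make
   [a] the least of three. *)
case: r by_ ew hh => [|c r]; last first.
  by move=> h ew; move: hw h; rewrite -ew /=; case: r ew => [|? ?] /= _; lia.
move=> _ /= ew hh; rewrite le_ay /=.
case: rs hh hb ew => [|[|c r'] rs] //= hh; rewrite block_seq_cons => /and3P[hc hrs _] ew.
move: hw aw; rewrite -ew /= inE negb_or => hw /andP[ac _].
(* The head [c] of the next run comes right after [y]. As [a < y] and [a] is not the least of the
   three, [c] lies below [a], so the heads still decrease. *)
have lt_ca : c < a by lia.
rewrite {1}/head_gt /= lt_ca /=; apply/allP => q /(allP hrs); rewrite /head_gt /=; lia.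
Qed.

(** The last element of a block is at least its head, hence exceeds the head of the next block:
    adjacent blocks never merge. *)
Lemma block_seq_runs bs : block_seq bs -> runs (flatten bs) = bs.
Proof.
elim: bs => [|b bs IH] //; rewrite block_seq_cons => /and3P[hb hh hbs].
rewrite /=; move: (IH hbs); case: (blockP hb) => [[x eb]|[x [y [xy eb]]]]; subst b => /= ->.
  case: bs hh hbs {IH} => [|[|c r] bs] //=; rewrite /head_gt /=.
  by case/andP=> cx _ _; case: ltnP => //; lia.
case: bs hh hbs {IH} => [|[|c r] bs] //=; rewrite /head_gt /=; first by rewrite xy.
by case/andP=> cx _ _; case: ltnP => //=; rewrite ?xy //; lia.
Qed.

(** The head of the next block, if there is one, is smaller than every entry of the current block
    and comes at most two places later. *)
Lemma block_seq_no_min_first bs : block_seq bs -> no_min_first (flatten bs).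
Proof.
elim: bs => [|b bs IH] //; rewrite block_seq_cons => /and3P[hb hh hbs].
move: (IH hbs); case: bs hh hbs {IH} => [|[|c r] bs] //=.
  by case: (blockP hb) => [[x ->]|[x [y [xy ->]]]].
rewrite /head_gt /= => /andP[cb _] _ h.
case: (blockP hb) cb => [[x ->]|[x [y [xy ->]]]] /=.
  by move=> cx; rewrite h andbT; case: (r ++ _) => //=; lia.
by move=> cx; rewrite h andbT; case: (r ++ _) => /= *; lia.
Qed.

(** * Consecutive patterns in one-line notation *)

Lemma order_isomorphic3 (a b c x y z : nat) :
  order_isomorphic [:: a; b; c] [:: x; y; z] =
  [&& (a < b) == (x < y), (a < c) == (x < z), (b < a) == (y < x),
      (b < c) == (y < z), (c < a) == (z < x) & (c < b) == (z < y)].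
Proof.
apply/idP/idP => [/andP[_ /forallP h]|].
  have g i j (hi : i < 3) (hj : j < 3) := forallP (h (Ordinal hi)) (Ordinal hj).
  move: (g 0 1 isT isT) (g 0 2 isT isT) (g 1 0 isT isT).
  move: (g 1 2 isT isT) (g 2 0 isT isT) (g 2 1 isT isT) => /=.
  by do 6![move->].
case/and5P=> h1 h2 h3 h4 /andP[h5 h6]; rewrite /order_isomorphic /=.
apply/forallP => -[[|[|[|//]]] hi]; apply/forallP => -[[|[|[|//]]] hj] //=.
all: by rewrite !ltnn.
Qed.

Lemma has_consecutive_cons (p : seq nat) a w : has_consecutive p (a :: w) =
  order_isomorphic (take (size p) (a :: w)) p || has_consecutive p w.
Proof.
apply/existsP/orP => [[[[|k] hk]]|[h|/existsP[k h]]].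
- by rewrite drop0; left.
- by move=> h; right; apply/existsP; exists (Ordinal (hk : k < size w)).
- by exists ord0; rewrite drop0.
- by exists (lift ord0 k).
Qed.

(** With distinct entries, three consecutive ones form 132 or 123 exactly when the first is the
    least; the order of the other two decides which. *)
Lemma no_min_firstE w : uniq w ->
  no_min_first w =
  all (fun p => ~~ has_consecutive p w) [:: [:: 1; 3; 2]; [:: 1; 2; 3]].
Proof.
elim: w => [_|a w IH].
  by apply/esym/allP => p _; apply/existsP => -[[]].
rewrite cons_uniq => /andP[aw uw]; rewrite [LHS]/= IH //=.
rewrite !has_consecutive_cons.
case: w aw uw {IH} => [|b [|c w]] //= aw uw.
rewrite !take0 !order_isomorphic3 /=.
move: aw uw; rewrite !inE !negb_or => /and3P[ab ac _] /andP[/andP[bc _] _].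
by case: (has_consecutive [:: 1; 3; 2] _); case: (has_consecutive [:: 1; 2; 3] _) => /=; rewrite ?andbF ?andbT //; lia.
Qed.

Lemma perm_one_line n (s : 'S_n) : perm_eq (one_line s) (iota 0 n).
Proof.
apply: uniq_perm; rewrite ?iota_uniq //.
  by rewrite map_inj_uniq ?enum_uniq // => i j /val_inj/perm_inj.
move=> x; rewrite mem_iota /= add0n; apply/mapP/idP => [[i _ ->]|hx]; first exact: ltn_ord.
by exists ((s^-1)%g (Ordinal hx)); rewrite ?mem_enum // permKV.
Qed.

Lemma SavE n (s : 'S_n) : (s \in Sav n [:: [:: 1; 3; 2]; [:: 1; 2; 3]]) =
  no_min_first (one_line s).
Proof.
by rewrite inE no_min_firstE // (perm_uniq (perm_one_line s)) iota_uniq.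
Qed.

(** * Steps and labels of [Gamma] read off the blocks *)

Lemma block_unique (T : eqType) (bs : seq (seq T)) r r' x : uniq (flatten bs) ->
  r \in bs -> r' \in bs -> x \in r -> x \in r' -> r = r'.
Proof.
elim: bs => [|b bs IH] //=; rewrite cat_uniq => /and3P[ub /hasPn h ubs].
have hb q : q \in bs -> x \in q -> x \notin b.
  by move=> qbs xq; apply: h; apply/flattenP; exists q.
rewrite !inE => /predU1P[->|rbs] /predU1P[->|r'bs] // xr xr'.
- by move: (hb _ r'bs xr'); rewrite xr.
- by move: (hb _ rbs xr); rewrite xr'.
- exact: IH.
Qed.

Lemma block_seq_index bs r r' x y : block_seq bs -> uniq (flatten bs) ->
  r \in bs -> r' \in bs -> x \in r -> y \in r' -> head_gt r r' ->
  index x (flatten bs) < index y (flatten bs).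
Proof.
elim: bs => [|b bs IH] //; rewrite block_seq_cons => /and3P[bb hh hbs] /=.
rewrite cat_uniq => /and3P[ub /hasPn h ubs].
have hb q z : q \in bs -> z \in q -> z \notin b.
  by move=> qbs zq; apply: h; apply/flattenP; exists q.
rewrite !inE !index_cat => /predU1P[->|rbs] /predU1P[->|r'bs] // xr yr.
- by rewrite /head_gt ltnn.
- move=> _; rewrite xr (negbTE (hb _ _ r'bs yr)).
  by apply: leq_trans (leq_addr _ _); rewrite index_mem.
- by have := allP hh _ rbs; rewrite /head_gt => h1 h2; lia.
- move=> hr; rewrite (negbTE (hb _ _ r'bs yr)) (negbTE (hb _ _ rbs xr)).
  by rewrite ltn_add2l; apply: IH hr.
Qed.

Section GammaBlocks.

Variable bs : seq (seq nat).
Hypotheses (bs_ok : block_seq bs) (bs_uniq : uniq (flatten bs)).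

Let blk r : r \in bs -> block r.
Proof. by move=> rbs; case/andP: bs_ok => /allP h _; apply: h. Qed.

Let head_mem r : r \in bs -> head 0 r \in r.
Proof. by case: r => [/blk|a r _] //=; rewrite inE eqxx. Qed.

Let last_mem r : r \in bs -> last 0 r \in r.
Proof. by case: r => [/blk|a r _] //=; apply: mem_last. Qed.

Lemma block_cases i : i \in flatten bs ->
  [\/ [:: i] \in bs, exists2 j, i < j & [:: i; j] \in bs
    | exists2 j, j < i & [:: j; i] \in bs].
Proof.
case/flattenP => r rbs ir; move: (rbs) ir.
case: (blockP (blk rbs)) => [[a ->]|[a [b [ab ->]]]] => h.
  by rewrite inE => /eqP->; constructor 1.
rewrite !inE => /orP[] /eqP->; first by constructor 2; exists b.
by constructor 3; exists a.
Qed.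

Lemma Gamma_step_single i : [:: i] \in bs -> Gamma_step (flatten bs) i = Hor.
Proof.
move=> h; rewrite /Gamma_step /is_head_tail block_seq_runs //.
by case: hasP => // -[]; exists [:: i].
Qed.

Let not_head_tail i r : r \in bs -> 1 < size r -> i \in r ->
  has (fun q => q == [:: i]) bs = false.
Proof.
move=> rbs sr ir; apply/hasP => -[q qbs /eqP eq]; subst q.
have ii : i \in [:: i] by rewrite inE.
by rewrite (block_unique bs_uniq rbs qbs ir ii) in sr.
Qed.

Lemma Gamma_step_fst i j : [:: i; j] \in bs -> Gamma_step (flatten bs) i = Up.
Proof.
move=> h; rewrite /Gamma_step /is_head_tail /is_head block_seq_runs //.
rewrite (not_head_tail h) ?inE ?eqxx //.
by case: hasP => // -[]; exists [:: i; j] => //=.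
Qed.

Lemma Gamma_step_snd i j : [:: j; i] \in bs -> Gamma_step (flatten bs) i = Down.
Proof.
move=> h; have := blk h => /= ji.
rewrite /Gamma_step /is_head_tail /is_head /is_tail block_seq_runs //.
rewrite (not_head_tail h) ?inE ?eqxx ?orbT //.
case: hasP => [[r rbs /andP[_ /eqP hr]]|_].
  have ir : i \in r by rewrite -hr head_mem.
  have := block_unique bs_uniq h rbs _ ir; rewrite !inE eqxx orbT => /(_ isT) er.
  by move: hr; rewrite -er /=; lia.
by case: hasP => // -[]; exists [:: j; i] => //=.
Qed.

(** Turns positions into values: heads decrease along the word, and distinct blocks have distinct
    heads, so the implication can be reversed. *)
Lemma precedes_head_gt r q i : r \in bs -> q \in bs -> i \in q -> r <> q ->
  precedes (flatten bs) (last 0 r) i = (head 0 q < head 0 r).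
Proof.
move=> rbs qbs iq rq; rewrite /precedes; apply/idP/idP => [|hh]; last first.
  exact: (block_seq_index bs_ok bs_uniq rbs qbs (last_mem rbs) iq hh).
apply: contraTT; rewrite -!leqNgt leq_eqVlt => /orP[/eqP e|hh]; last first.
  exact/ltnW/(block_seq_index bs_ok bs_uniq qbs rbs iq (last_mem rbs) hh).
by case: rq; apply: (block_unique bs_uniq rbs qbs (head_mem rbs)); rewrite e head_mem.
Qed.

(** This form matches the label in [Psi], with the head of [q] in the role of [s i]. The block [q]
    itself counts on neither side: on the left because [i] is one of its endpoints, on the right by
    irreflexivity. *)
Lemma Gamma_labelE q i : q \in bs -> i \in q ->
  Gamma_label (flatten bs) i =
  count (fun r => (head 0 q < head 0 r < i) && (i < last 0 r)) bs.
Proof.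
move=> qbs iq; rewrite /Gamma_label block_seq_runs //.
apply: eq_in_count => r rbs /=.
have [e|/eqP rq] := eqVneq r q; last first.
  by rewrite (precedes_head_gt rbs qbs iq rq); lia.
subst q; rewrite ltnn /=; move: iq.
by case: (blockP (blk rbs)) => [[a ->]|[a [b [ab ->]]]]; rewrite !inE /=; lia.
Qed.

Lemma Gamma_label_head q : q \in bs -> Gamma_label (flatten bs) (head 0 q) = 0.
Proof.
move=> qbs; rewrite (Gamma_labelE qbs (head_mem qbs)).
by rewrite (@eq_count _ _ pred0) ?count_pred0 // => r /=; lia.
Qed.

Definition open_at k : nat := count (fun r => head 0 r < k <= last 0 r) bs.

(** Passing from [k] to [k.+1] affects only the block containing [k], since no other block has [k]
    as an endpoint; that block opens, closes or does neither, according to the step. *)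
Lemma open_atS k : k \in flatten bs ->
  ((open_at k.+1)%:Z = (open_at k)%:Z + rise (Gamma_step (flatten bs) k))%R.
Proof.
move=> kbs; have /flattenP[r rbs kr] := kbs.
have /seq.permP ebs := perm_to_rem rbs.
rewrite /open_at !ebs /=.
rewrite (@eq_in_count _ (fun r => head 0 r < k.+1 <= last 0 r)
           (fun r => head 0 r < k <= last 0 r)); last first.
  move=> q; rewrite mem_rem_uniq ?block_seq_uniq // inE => /andP[/eqP qr qbs] /=.
  have kq x : x \in q -> x != k.
    by move=> xq; apply/eqP => e; case: qr; apply: (block_unique bs_uniq qbs rbs xq); rewrite e.
  by have := kq _ (head_mem qbs); have := kq _ (last_mem qbs); lia.
set c := count _ _.
move: kr (rbs); case: (blockP (blk rbs)) => [[a ->]|[a [b [ab ->]]]]; rewrite !inE /=.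
  by move/eqP=> -> h; rewrite Gamma_step_single //=; lia.
case/orP=> /eqP-> h; first by rewrite (Gamma_step_fst h) /=; lia.
by rewrite (Gamma_step_snd h) /=; lia.
Qed.

End GammaBlocks.

(** * The image of the avoiding permutations lies in [calL] *)

Lemma ordinateS n (d : n.-tuple step) (k : 'I_n) :
  (ordinate d k.+1 = ordinate d k + rise (tnth d k))%R.
Proof.
rewrite /ordinate (take_nth Hor) ?size_tuple // -cats1 big_cat /= big_seq1.
by rewrite (tnth_nth Hor).
Qed.

Lemma Gamma_calL n (s : 'S_n) :
  s \in Sav n [:: [:: 1; 3; 2]; [:: 1; 2; 3]] -> calL (Gamma s).
Proof.
have pw := perm_one_line s.
have uw : uniq (one_line s) by rewrite (perm_uniq pw) iota_uniq.
rewrite SavE => /(runs_block_seq uw); have ew := flatten_runs (one_line s).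
move: (runs _) ew => bs ew ok; rewrite -ew in pw uw.
have mem (i : 'I_n) : val i \in flatten bs by rewrite (perm_mem pw) mem_iota /=.
rewrite /Gamma -ew; set d := [tuple _ | i < n]; set l := [tuple _ | i < n].
have dE i : tnth d i = Gamma_step (flatten bs) i by rewrite tnth_mktuple.
have lE i : tnth l i = Gamma_label (flatten bs) i by rewrite tnth_mktuple.
have ord k : k <= n -> ordinate d k = (open_at bs k)%:Z%R.
  elim: k => [|k IH] hk.
    by rewrite /ordinate take0 big_nil /open_at (@eq_count _ _ pred0) ?count_pred0.
  rewrite (ordinateS d (Ordinal hk)) /= IH 1?ltnW // dE open_atS //.
  exact: (mem (Ordinal hk)).
(* [open_at bs i.+1] is the height of a down step [i]; every run counted by its label has its last
   element beyond [i], so it is still open there. *)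
have lab i : tnth l i = 0 \/ tnth d i = Down /\ tnth l i <= open_at bs i.+1.
  case: (block_cases ok (mem i)) => [h|[j ij h]|[j ji h]].
  - by left; rewrite lE (Gamma_label_head ok uw h).
  - by left; rewrite lE (Gamma_label_head ok uw h).
  right; split; first by rewrite dE (Gamma_step_snd ok uw h).
  rewrite lE /Gamma_label block_seq_runs //; apply: sub_count => r /=; lia.
apply/and3P; split.
- apply/andP; split; first apply/and3P; first split.
  + by apply/forallP => k; rewrite ord // -ltnS.
  (* All values are below [n], so no run is open at abscissa [n]. *)
  + rewrite ord // /open_at (@eq_in_count _ _ pred0) ?count_pred0 // => r rbs /=.
    have : last 0 r \in flatten bs.
      apply/flattenP; exists r => //; case/andP: ok => /allP/(_ _ rbs).
      by case: r {rbs} => //= a r _ _; apply: mem_last.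
    by rewrite (perm_mem pw) mem_iota /=; lia.
  + apply/forallP => i; apply/implyP; rewrite dE => /eqP.
    case: (block_cases ok (mem i)) => [h|[j ij h]|[j ji h]].
    * by rewrite Gamma_step_single.
    * by rewrite (Gamma_step_fst ok uw h).
    * by rewrite (Gamma_step_snd ok uw h).
  apply/forallP => i; rewrite /height /= !ord //; last exact: ltnW.
  by case: (lab i) => [-> | [-> h]] /=; [case: ifP | rewrite lez_nat].
- apply/forallP => i; rewrite dE.
  case: (block_cases ok (mem i)) => [h|[j ij h]|[j ji h]].
  + by rewrite Gamma_step_single.
  + by rewrite (Gamma_step_fst ok uw h).
  + by rewrite (Gamma_step_snd ok uw h).
- by apply/forallP => i /=; case: (lab i) => [-> | [-> _]]; rewrite ?eqxx ?implybT.
Qed.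

(** * Involutions and the map [Fmap] *)

Lemma involutionsP n (s : 'S_n) : reflect (involutive s) (s \in involutions n).
Proof.
rewrite inE; apply: (iffP eqP) => [h i|h]; first by rewrite -permM h perm1.
by apply/permP => i; rewrite permM h perm1.
Qed.

Definition cycle_block n (s : 'S_n) (i : 'I_n) : seq nat :=
  if s i == i then [:: val i] else [:: val i; val (s i)].

(** In an involution, [i <= s i] singles out the least elements of the cycles; reversing the
    enumeration lists them in the decreasing order of the standard notation. *)
Definition cycle_blocks n (s : 'S_n) : seq (seq nat) :=
  [seq cycle_block s i | i : 'I_n <- rev (enum 'I_n) & i <= s i].

Lemma count_enum_ord n (P : pred nat) :
  count (fun x : 'I_n => P x) (enum 'I_n) = count P (iota 0 n).
Proof. by rewrite -val_enum_ord count_map. Qed.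

Lemma count_enum (T : finType) (P : pred T) :
  count P (enum T) = #|[set x | P x]|.
Proof. by rewrite cardsE cardE [in RHS]/enum_mem size_filter enumT. Qed.

Section Involution.

Variables (n : nat) (s : 'S_n).
Hypothesis sK : involutive s.

Lemma orbit_involutive i :
  fingraph.orbit s i = if s i == i then [:: i] else [:: i; s i].
Proof.
rewrite /fingraph.orbit; have [si|si] := eqVneq (s i) i.
  have -> : fingraph.order s i = size [:: i]; last by [].
  by apply: (@order_cycle _ s [:: i]); rewrite ?inE //= si eqxx.
have -> : fingraph.order s i = size [:: i; s i]; last by [].
apply: (@order_cycle _ s [:: i; s i]); rewrite ?inE /= ?sK ?eqxx //.
by rewrite inE eq_sym si.
Qed.

Lemma one_line_Fmap_involutive : one_line (Fmap s) = flatten (cycle_blocks s).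
Proof.
rewrite one_line_Fmap /F_word /standard_cycles /cycle_blocks map_flatten -map_comp.
congr flatten; rewrite (@eq_filter _ _ (fun i : 'I_n => i <= s i)); last first.
  move=> i; rewrite orbit_involutive; case: eqP => [->|_] /=; lia.
by apply: eq_map => i /=; rewrite orbit_involutive /cycle_block; case: eqP.
Qed.

Lemma head_cycle_block i : head 0 (cycle_block s i) = i.
Proof. by rewrite /cycle_block; case: eqP. Qed.

Lemma last_cycle_block i : last 0 (cycle_block s i) = s i.
Proof. by rewrite /cycle_block; case: eqP => [->|]. Qed.

Lemma block_seq_cycle_blocks : block_seq (cycle_blocks s).
Proof.
apply/andP; split.
  apply/allP => _ /mapP[i + ->]; rewrite mem_filter => /andP[lei _].
  rewrite /cycle_block; case: eqP => //= /eqP si.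
  by rewrite ltn_neqAle lei andbT eq_sym.
rewrite sorted_map; apply: sorted_filter.
  by move=> x y z; rewrite /= /head_gt => h1 h2; apply: ltn_trans h2 h1.
rewrite rev_sorted /head_gt.
have := iota_ltn_sorted 0 n; rewrite -val_enum_ord sorted_map.
by apply: sub_sorted => x y /=; rewrite !head_cycle_block.
Qed.

Lemma mem_cycle_blocks (i : 'I_n) : i <= s i -> cycle_block s i \in cycle_blocks s.
Proof. by move=> h; apply: map_f; rewrite mem_filter h mem_rev mem_enum. Qed.

Lemma count_cycle_blocks (P : pred (seq nat)) : count P (cycle_blocks s) =
  count (fun i : 'I_n => (i <= s i) && P (cycle_block s i)) (enum 'I_n).
Proof.
rewrite count_map count_filter count_rev; apply: eq_count => i /=; exact: andbC.
Qed.

Lemma Psi_stepE i : Psi_step s i =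
  if s i == i then Hor else if i < s i then Up else Down.
Proof.
rewrite /Psi_step; case: eqP => // _; congr (if _ then _ else _).
apply/existsP/idP => [[j /and3P[/= ij /eqP -> _]] //|h].
by exists (s i); rewrite /is_2cycle /= h sK !eqxx.
Qed.

(** A 2-cycle is determined by its smaller element [x], so pairs are counted by [x] alone; [x < s x]
    follows from [x < i < s x]. *)
Lemma Psi_labelE i : Psi_label s i = if s i < i then
  count (fun x : 'I_n => (s i < x < i) && (i < s x)) (enum 'I_n) else 0.
Proof.
rewrite /Psi_label Psi_stepE -(inj_eq val_inj) /=.
case: (ltngtP (s i) i) => [h|h|h] //=.
rewrite count_enum.
pose f (x : 'I_n) := (x, s x).
have fi : injective f by move=> x y [].
rewrite -(card_imset _ fi); congr #|pred_of_set _|; apply/setP => -[x y].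
rewrite inE /=; apply/idP/imsetP => [|[z + [-> ->]]].
  case/andP=> /andP[/and3P[/= xy /eqP sx _] h1] h2.
  by exists x; rewrite ?inE /f /= sx // h1.
rewrite inE => /andP[/andP[h1 h2] h3].
by rewrite /is_2cycle /= sK !eqxx h1 h2 h3 !andbT; lia.
Qed.

Lemma Gamma_Fmap : Gamma (Fmap s) = Psi s.
Proof.
have ok := block_seq_cycle_blocks.
have uw : uniq (flatten (cycle_blocks s)).
  by rewrite -one_line_Fmap_involutive (perm_uniq (perm_one_line _)) iota_uniq.
rewrite /Gamma /Psi one_line_Fmap_involutive; congr pair; apply: eq_mktuple => i.
  rewrite Psi_stepE; case: (ltngtP (s i) i) => hs.
  - have : cycle_block s (s i) \in cycle_blocks s.
      by apply: mem_cycle_blocks; rewrite sK ltnW.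
    rewrite /cycle_block sK; case: eqP => [e|_ h]; first by rewrite -e ltnn in hs.
    by rewrite (Gamma_step_snd ok uw h); case: eqP => [e|] //; rewrite e ltnn in hs.
  - have := mem_cycle_blocks (ltnW hs); rewrite /cycle_block.
    case: eqP => [e|_ h]; first by rewrite e ltnn in hs.
    by rewrite (Gamma_step_fst ok uw h).
  - have := mem_cycle_blocks (eq_leq (esym hs)); rewrite /cycle_block.
    by rewrite (val_inj hs) eqxx => h; rewrite (Gamma_step_single ok h).
rewrite Psi_labelE; case: ltnP => hs; last first.
  have h := mem_cycle_blocks hs.
  by have := Gamma_label_head ok uw h; rewrite head_cycle_block.
(* The run of a tail [i] is the block headed by its partner [s i], so [Gamma_labelE] and
   [Psi_labelE] count the same elements [x]. *)
have h : cycle_block s (s i) \in cycle_blocks s.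
  by apply: mem_cycle_blocks; rewrite sK ltnW.
have ih : val i \in cycle_block s (s i).
  by rewrite /cycle_block sK; case: eqP => [<-|_]; rewrite !inE eqxx ?orbT.
rewrite (Gamma_labelE ok uw h ih) count_cycle_blocks; apply: eq_count => x /=.
rewrite !head_cycle_block last_cycle_block; lia.
Qed.

Lemma Fmap_Sav : Fmap s \in Sav n [:: [:: 1; 3; 2]; [:: 1; 2; 3]].
Proof.
rewrite SavE one_line_Fmap_involutive.
exact: block_seq_no_min_first block_seq_cycle_blocks.
Qed.

End Involution.

(** * Reconstruction of an involution from a labelled path *)

(** Finds the up step prescribed by a label, [t] being the list of waiting ones. The first element
    of [t] has all the others above it, and the tail provides the smaller ranks. *)
Lemma exists_rank_from_top (t : seq nat) (l : nat) :
  sorted ltn t -> l < size t -> exists2 j, j \in t & count (ltn j) t = l.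
Proof.
elim: t => [|a t IH] //=; rewrite (path_sortedE ltn_trans) => /andP[at_ st].
rewrite ltnS leq_eqVlt => /predU1P[->|/(IH st)[j jt <-]].
  exists a; first by rewrite inE eqxx.
  by rewrite ltnn add0n; apply/eqP; rewrite -all_count.
exists j; first by rewrite inE jt orbT.
by have := allP at_ _ jt => /= aj; rewrite ltnNge ltnW.
Qed.

Section Surjectivity.

Variables (n : nat) (d : n.-tuple step) (l : n.-tuple nat).

(* [f] matches the steps before abscissa [k]; [f x = n] means that the up
   step [x] is still waiting for its down step. *)
Definition partial_matching (k : nat) (f : nat -> nat) : Prop :=
  [/\ forall i, i < k -> f i = n \/ f i < k /\ f (f i) = i,
      forall i : 'I_n, i < k ->
        tnth d i = if f i == i then Hor else if i < f i then Up else Down,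
      forall i : 'I_n, i < k ->
        tnth l i = if f i < i
                   then count (fun x => (f i < x < i) && (i < f x)) (iota 0 n)
                   else 0
    & ordinate d k = (count (fun x => f x == n) (iota 0 k))%:Z%R].

Hypothesis dl_ok : calL (d, l).

(** Induction on [k]. The placeholder [n] exceeds every index, so in the step and label clauses at
    [i < k] a waiting up step behaves as it will once matched at or after [k]. *)
Lemma partial_matching_exists k : k <= n -> exists f, partial_matching k f.
Proof.
case/and3P: (dl_ok) => /andP[/and3P[_ _ _] /forallP hl] /forallP h2 /forallP h0.
elim: k => [_|k IH kn].
  by exists id; split=> //; rewrite /ordinate take0 big_nil.
have [f [fA fB fC fD]] := IH (ltnW kn); pose o := Ordinal kn.
have oS := ordinateS d o.
have fn x : x < k -> f x <= n.
  by move=> xk; case: (fA _ xk) => [->|[h _]] //; lia.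
have last_or_lt (i : 'I_n) : i < k.+1 -> i = o \/ i < k.
  by rewrite ltnS leq_eqVlt => /predU1P[e|]; [left; apply: val_inj | right].
have cntS (g : nat -> nat) : count (fun x => g x == n) (iota 0 k.+1) =
    count (fun x => g x == n) (iota 0 k) + (g k == n).
  by rewrite -addn1 iotaD count_cat /= add0n addn0.
have lab0 : tnth d o != Down -> tnth l o = 0.
  by move/negbTE=> hd; have := h0 o; rewrite /= hd implybF lt0n negbK => /eqP.
(* Common to a new up step ([v = n], left waiting) and a new fixed point ([v = k]); neither alters
   [f] below [k]. *)
have extend v : v = n \/ v = k ->
    tnth d o = (if v == k then Hor else if k < v then Up else Down) ->
    partial_matching k.+1 (fun x => if x == k then v else f x).
  move=> hv dv; have kv : k <= v by lia.
  split.
  - move=> i; rewrite ltnS leq_eqVlt => /predU1P[->|ik].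
      by rewrite eqxx; case: hv => [->|->]; [left | right; rewrite eqxx].
    rewrite (_ : i == k = false); last by lia.
    case: (fA _ ik) => [e|[h1 h3]]; first by left.
    by right; rewrite (_ : f i == k = false) ?h3; lia.
  - move=> i /last_or_lt[->|ik] /=; first by rewrite eqxx.
    by rewrite (_ : i == k :> nat = false) ?fB //; lia.
  - move=> i /last_or_lt[->|ik].
      rewrite /= eqxx ltnNge kv /= lab0 // dv; case: ifP => //; case: ifP => //; lia.
    rewrite fC // (_ : i == k :> nat = false); last by lia.
    case: ifP => // _; apply: eq_count => x; case: eqP; lia.
  rewrite oS fD cntS eqxx dv [in RHS](@eq_in_count _ _ (fun x => f x == n)).
    case: hv => ->; rewrite eqxx; last by rewrite (ltn_eqF kn) /=; lia.
    by rewrite (gtn_eqF kn) kn /=; lia.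
  by move=> x; rewrite mem_iota /= => xk; rewrite (_ : x == k = false) //; lia.
case ek : (tnth d o).
- exists (fun x => if x == k then n else f x); apply: extend; first by left.
  by rewrite ek (gtn_eqF kn) kn.
- pose t := [seq x <- iota 0 k | f x == n].
  have st : sorted ltn t by apply: sorted_filter (iota_ltn_sorted _ _); apply: ltn_trans.
  (* The label is at most the ordinate after the down step, which is one less than the number of
     waiting up steps. *)
  have lt_l : tnth l o < size t.
    have := hl o; rewrite /height /= ek oS ek fD size_filter /=; lia.
  have [j] := exists_rank_from_top st lt_l.
  rewrite mem_filter mem_iota add0n /= => /andP[/eqP fj jk].
  rewrite count_filter => lj.
  exists (fun x => if x == k then j else if x == j then k else f x); split.
  + move=> i; rewrite ltnS leq_eqVlt => /predU1P[->|ik].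
      by right; rewrite eqxx (_ : j == k = false) ?eqxx; lia.
    rewrite (_ : i == k = false); last by lia.
    have [->|ij] := eqVneq i j; first by right; rewrite eqxx.
    case: (fA _ ik) => [e|[h1 h3]]; first by left.
    right; split; first by lia.
    rewrite (_ : f i == k = false); last by lia.
    by case: eqP => [e|//]; move: h3; rewrite e fj; lia.
  + move=> i /last_or_lt[->|ik]; first by rewrite /= eqxx ek (ltn_eqF jk) ltnNge ltnW.
    rewrite fB // (_ : i == k :> nat = false); last by lia.
    case: (eqVneq (val i) j) => // ->.
    by rewrite fj (gtn_eqF (ltn_trans jk kn)) (gtn_eqF jk) jk (ltn_trans jk kn).
  + move=> i /last_or_lt[->|ik].
      (* Indices from [k] on contribute nothing. Below [k], matched indices have [f x < k], so those
         counted are the waiting ones after [j], and there are [tnth l o] of them. *)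
      rewrite /= eqxx jk -lj -(subnKC (ltnW kn)) iotaD count_cat /= add0n.
      rewrite [X in _ = _ + X](@eq_in_count _ _ pred0) ?count_pred0 ?addn0.
        apply: eq_in_count => x; rewrite mem_iota /= => xk.
        rewrite (_ : x == k = false); last by lia.
        case: (eqVneq x j) => [->|_]; first by lia.
        by case: (fA _ (xk : x < k)) => [e|[h1 h3]]; lia.
      by move=> x; rewrite mem_iota /=; lia.
    rewrite fC // (_ : i == k :> nat = false); last by lia.
    have [e|ij] := eqVneq (val i) j.
      by rewrite e fj; case: ltnP => [|_]; [lia | case: ltnP => //; lia].
    (* Among indices below [i], only [j] can change its value, from [n] to [k]; both exceed [i], so
       earlier labels are kept. *)
    case: ifP => // _; apply: eq_count => x; case: (eqVneq x k) => [|_]; first by lia.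
    by case: (eqVneq x j) => [->|_]; rewrite ?fj; lia.
  + rewrite oS ek fD cntS eqxx (_ : j == n = false) /=; last by lia.
    have /perm_to_rem/seq.permP ej : j \in iota 0 k by rewrite mem_iota.
    rewrite !ej /= fj !eqxx (_ : j == k = false); last by lia.
    rewrite (_ : k == n = false); last by lia.
    rewrite [in RHS](@eq_in_count _ _ (fun x : nat => f x == n)); first by rewrite addn0; set c := count _ _; lia.
    move=> x; rewrite mem_rem_uniq ?iota_uniq // inE mem_iota /= => /andP[/negbTE-> xk].
    by rewrite (ltn_eqF xk).
- by exists (fun x => if x == k then k else f x); apply: extend; [right | rewrite ek eqxx].
- by have := h2 o; rewrite /= ek.
Qed.

Lemma calL_Psi : exists2 s : 'S_n, s \in involutions n & Psi s = (d, l).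
Proof.
have [f [fA fB fC fD]] := partial_matching_exists (leqnn n).
(* The path ends at ordinate 0, so no up step is still waiting at abscissa [n]. *)
have fn x : x < n -> f x < n.
  move=> xn; case: (fA _ xn) => [e|[]//].
  case/and3P: dl_ok => /andP[/and3P[_ /eqP]] /=; rewrite fD => -[/eqP].
  rewrite -leqn0 leqNgt -has_count => /hasPn/(_ x).
  by rewrite mem_iota e eqxx => /(_ xn).
have fK x : x < n -> f (f x) = x.
  by move=> xn; case: (fA _ xn) => [e|[]//]; have := fn _ xn; lia.
pose g (i : 'I_n) := Ordinal (fn i (ltn_ord i)).
have gK : involutive g by move=> i; apply: val_inj; rewrite /= fK.
exists (perm (inv_inj gK)).
  by apply/involutionsP => i; rewrite !permE.
have sK : involutive (perm (inv_inj gK)) by move=> i; rewrite !permE.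
congr pair; apply: eq_from_tnth => i; rewrite tnth_mktuple.
  by rewrite Psi_stepE // permE -(inj_eq val_inj) fB.
rewrite Psi_labelE // permE fC //=; case: ifP => // _.
rewrite -count_enum_ord; apply: eq_count => x /=; by rewrite permE.
Qed.

End Surjectivity.

Theorem theorem2p2 (n : nat) (n_ge1 : 1 <= n) :
  (forall dl : histoire n,
     (exists2 s : 'S_n, s \in Sav n [:: [:: 1; 3; 2]; [:: 1; 2; 3]]
                      & Gamma s = dl)
     <-> calL dl)
  /\ (forall s : 'S_n, s \in involutions n ->
        Fmap s \in Sav n [:: [:: 1; 3; 2]; [:: 1; 2; 3]]
        /\ Gamma (Fmap s) = Psi s).
Proof.
split=> [[d l]|s /involutionsP sK]; last first.
  by split; [exact: Fmap_Sav | exact: Gamma_Fmap].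
split=> [[s sS <-]|h]; first exact: Gamma_calL.
(* A preimage under [Gamma] is found among the images of involutions: [Psi] reaches every element of
   [calL] and factors through [Fmap]. *)
have [s /involutionsP sK <-] := calL_Psi h.
by exists (Fmap s); [exact: Fmap_Sav | exact: Gamma_Fmap].
Qed.
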